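(* Let $m$ be an odd positive integer, let $n$ and $d$ be positive integers with $m<d$, and let $b$ be a real number with $b\notin \mathbb{Z}/d$. Put $p_1=e^{-\pi i m(b-1)}$, $p_2=e^{-2\pi i db}$, $p_1'=e^{\pi i m(b-1)}$ and $p_2'=e^{2\pi i db}$. Then $$\sum_{j=1}^{d-1} \sin\Big(\frac{\pi mj}{d}\Big)\csc^{2n-1}\Big(\frac{\pi j}{d}+\pi b\Big) = -\sum i^{\mu+\nu}\,2^{\nu}\,\frac{m^\mu}{\mu!}\,\frac{d^{\nu+1}}{\nu!}\Big(p_1 A_\nu(p_2)+(-1)^{\mu+\nu}p_1' A_\nu(p_2')\Big)F(j_1,\ldots,j_{2n-1}),$$ where the sum on the right is over all nonnegative integers $j_1,\ldots,j_{2n-1},\mu,\nu$ such that $2j_1+\cdots+2j_{2n-1}+\mu+\nu=2n-2$ (so that $\mu+\nu$ is even).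
   Context: Here $i$ is the imaginary unit, $\csc$ denotes the cosecant, and $\mathbb{Z}/d=\{k/d : k\in\mathbb{Z}\}$. For a complex number $t\neq 1$, the numbers $A_\nu(t)$, $\nu\ge 0$, are defined by the power series expansion about $z=0$: $\frac{1}{te^z-1}=\sum_{\nu=0}^{\infty}\frac{A_\nu(t)}{\nu!}z^\nu$ (e.g. $A_0(t)=\frac{1}{t-1}$, $A_1(t)=\frac{-t}{(t-1)^2}$). For $j\ge 0$, $G_j=\frac{(-1)^j\,2(2^{2j-1}-1)B_{2j}}{(2j)!}$, where $B_k$ are the Bernoulli numbers ($\frac{x}{e^x-1}=\sum_{k\ge 0}B_k\frac{x^k}{k!}$); thus $G_0=-1$, $G_1=-\frac16$, $G_2=-\frac{7}{360}$, and these are the coefficients in $-\csc(\pi w)=\sum_{j\ge 0}G_j\pi^{2j-1}w^{2j-1}$ near $w=0$. Finally $F(j_1,\ldots,j_{N})=\prod_{r=1}^{N}G_{j_r}$. *)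

(* Defs.v *)
From HB Require Import structures.
From mathcomp Require Import all_boot all_order all_algebra.
From mathcomp Require Import all_classical all_reals all_analysis.
From mathcomp Require Export complex.

Set Implicit Arguments.
Unset Strict Implicit.
Unset Printing Implicit Defensive.

Import Order.TTheory GRing.Theory Num.Theory.
Import numFieldNormedType.Exports.

Local Open Scope classical_set_scope.
Local Open Scope ring_scope.
Local Open Scope complex_scope.

(* f z = \sum_k a_k / k! * z ^ k for z near 0. The neighbourhood is punctured
   because x / (e ^ x - 1) is only defined at 0 by continuity (in Rocq, 0 / 0
   is 0). The sequence a is unique when it exists. *)
Definition is_egf (K : numFieldType) (a : nat -> K) (f : K -> K) : Prop :=
  \forall z \near (0 : K)^',
    series (fun k => a k / (k`!)%:R * z ^+ k) @ \oo --> f z.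

Definition egf_coef (K : numFieldType) (f : K -> K) : nat -> K :=
  xget (fun=> 0) [set a | is_egf a f].

Definition cexp (R : realType) (z : R[i]) : R[i] :=
  (expR (complex.Re z))%:C * (cos (complex.Im z) +i* sin (complex.Im z)).

Definition csc (R : realType) (x : R) : R := (sin x)^-1.

Definition A (R : realType) (nu : nat) (t : R[i]) : R[i] :=
  egf_coef (fun z : R[i] => (t * cexp z - 1)^-1) nu.

Definition bernoulli_number (R : realType) (k : nat) : R :=
  egf_coef (fun x : R => x / (expR x - 1)) k.

(* The exponent 2j - 1 is an integer: it is -1 when j = 0. *)
Definition G (R : realType) (j : nat) : R :=
  (-1) ^+ j * 2 * (2 ^ ((2 * j)%:Z - 1) - 1) * bernoulli_number R (2 * j)
  / ((2 * j)`!)%:R.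

Definition F (R : realType) (N : nat) (j : 'I_N -> nat) : R :=
  \prod_(r < N) G R (j r).

(* Main.v *)
Require Import Defs.
From HB Require Import structures.
From mathcomp Require Import all_boot all_order all_algebra.
From mathcomp Require Import all_classical all_reals all_analysis.
From mathcomp Require Import complex.
From mathcomp Require Import zify ring.

Import Order.TTheory GRing.Theory Num.Theory.
Import numFieldNormedType.Exports.

Local Open Scope ring_scope.
Local Open Scope complex_scope.

(** Put N = 2n - 1 and x_j = pi j / d + pi b. The proof is a residue
    computation at z = 0, carried out in a ring of formal power series.

    Residue formula. For odd N, the residue at 0 of csc (x - z) / sin^N z is
    csc^N x; in other words csc^N x is the coefficient of z^{N-1} in
    csc (x - z) (z / sin z)^N (coef_fcscB_fxcscX). This follows by induction
    on N from sin (x - z) sin (x + z) = sin^2 x - sin^2 z, because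
    cos z / sin^{k+1} z has no residue for k > 0 (coef_fcos_fxcscX) and an even
    function has none either. Hence the sum on the left is the coefficient of
    z^{N-1} in K(z) (z / sin z)^N, where
      K(z) = sum_j sin (pi m j / d) csc (x_j - z).

    Closed form of K. Orthogonality of the d-th roots of unity gives
      sum_j sin (pi m j / d) csc (pi j / d + w) = d sin ((d - m) w) / sin (d w)
    (sum_kernel). At w = pi b - z the right-hand side is
      d (p1 e^{imz} / (p2 e^{2idz} - 1) + p1' e^{-imz} / (p2' e^{-2idz} - 1)),
    which expands with the exponential series and the numbers A_nu(p2) and
    A_nu(p2') (kernel_series). Since z / sin z = - sum_j G_j z^{2j}
    (coef_fxcsc_double), reading off the coefficient of z^{N-1} by
    distributivity (coef_mul_even_expn) yields the statement.

    Analysis enters only to identify A_nu(t) and B_k, which are defined through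
    convergent expansions, with formal coefficients (egf_coef_inv): a power
    series with nonzero constant term and bounded coefficients has a
    reciprocal that converges near 0 to the reciprocal function (is_egf_inv),
    power series expansions are unique (is_egf_uniq), and e^z for complex z is
    the sum of its series (cvg_series_fexpc). *)

Set Implicit Arguments.
Unset Strict Implicit.
Unset Printing Implicit Defensive.

(** * Formal power series *)

(** A record rather than a function type, so that the ring structure found on
    series is the Cauchy product and not the pointwise one. *)
Record fps (R : Type) := Fps { fps_coef : nat -> R }.
Coercion fps_coef : fps >-> Funclass.

HB.instance Definition _ (R : Type) := gen_eqMixin (fps R).
HB.instance Definition _ (R : Type) := gen_choiceMixin (fps R).

Lemma fpsP (R : Type) (f g : fps R) : f =1 g <-> f = g.
Proof.
split=> [|-> //]; case: f g => [f] [g] /= fg.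
by congr Fps; apply/funext.
Qed.

Section FpsRing.
Variable R : comNzRingType.
Implicit Types f g h : fps R.

Definition fps_zero : fps R := Fps (fun=> 0).
Definition fps_opp f : fps R := Fps (fun k => - f k).
Definition fps_add f g : fps R := Fps (fun k => f k + g k).

Let addA : associative fps_add.
Proof. by move=> f g h; apply/fpsP => k /=; rewrite addrA. Qed.
Let addC : commutative fps_add.
Proof. by move=> f g; apply/fpsP => k /=; rewrite addrC. Qed.
Let add0 : left_id fps_zero fps_add.
Proof. by move=> f; apply/fpsP => k /=; rewrite add0r. Qed.
Let addN : left_inverse fps_zero fps_opp fps_add.
Proof. by move=> f; apply/fpsP => k /=; rewrite addNr. Qed.

HB.instance Definition _ := GRing.isZmodule.Build (fps R) addA addC add0 addN.

Definition fpsC (c : R) : fps R := Fps (fun k => if k is 0%N then c else 0).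
Definition fps_mul f g : fps R :=
  Fps (fun k => \sum_(i < k.+1) f i * g (k - i)%N).

(** The ring axioms are inherited from polynomials: a coefficient of a product
    of series only depends on truncations of the factors. *)
Let trunc n f : {poly R} := \poly_(i < n) f i.

Let coef_mul_trunc n k f g : (k < n)%N ->
  fps_mul f g k = (trunc n f * trunc n g)`_k.
Proof.
move=> kn; rewrite coefM /=; apply: eq_bigr => i _.
rewrite !coef_poly (leq_ltn_trans _ kn) ?leq_ord //.
by rewrite (leq_ltn_trans _ kn) ?leq_subr.
Qed.

Let trunc_mul n k f g : (k < n)%N ->
  (trunc n (fps_mul f g))`_k = (trunc n f * trunc n g)`_k.
Proof. by move=> kn; rewrite coef_poly kn (coef_mul_trunc _ _ kn). Qed.

Let mulC : commutative fps_mul.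
Proof.
move=> f g; apply/fpsP => k.
by rewrite !(coef_mul_trunc _ _ (ltnSn k)) mulrC.
Qed.
Let mulA : associative fps_mul.
Proof.
move=> f g h; apply/fpsP => k.
rewrite !(coef_mul_trunc _ _ (ltnSn k)).
have -> : (trunc k.+1 f * trunc k.+1 (fps_mul g h))`_k =
          (trunc k.+1 f * (trunc k.+1 g * trunc k.+1 h))`_k.
  by rewrite !coefM; apply: eq_bigr => i _; rewrite trunc_mul // ltnS leq_subr.
rewrite mulrA !coefM; apply: eq_bigr => i _.
by rewrite [in RHS]trunc_mul.
Qed.
Let mul1 : left_id (fpsC 1) fps_mul.
Proof.
move=> f; apply/fpsP => k /=; rewrite big_ord_recl big1 => [|i _].
  by rewrite /= mul1r subn0 addr0.
by rewrite /= mul0r.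
Qed.
Let mulD : left_distributive fps_mul fps_add.
Proof.
move=> f g h; apply/fpsP => k /=; rewrite -big_split /=.
by apply: eq_bigr => i _; rewrite mulrDl.
Qed.
Let one_neq0 : fpsC 1 != 0.
Proof.
by apply/eqP => /fpsP/(_ 0%N) /= /eqP; rewrite oner_eq0.
Qed.

HB.instance Definition _ :=
  GRing.Zmodule_isComNzRing.Build (fps R) mulA mulC mul1 mulD one_neq0.

Lemma coef_fpsD f g k : (f + g) k = f k + g k. Proof. by []. Qed.
Lemma coef_fpsN f k : (- f) k = - f k. Proof. by []. Qed.
Lemma coef_fps1 k : (1 : fps R) k = (k == 0%N)%:R. Proof. by case: k. Qed.
Lemma coef_fpsM f g k : (f * g) k = \sum_(i < k.+1) f i * g (k - i)%N.
Proof. by []. Qed.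
Lemma coef_fpsC c k : fpsC c k = if k == 0%N then c else 0. Proof. by case: k. Qed.

Lemma coef_fpsMn f n k : (f *+ n) k = f k *+ n.
Proof. by elim: n => [|n IH]; rewrite ?mulr0n // !mulrS coef_fpsD IH. Qed.

Lemma coef_fps_sum I (r : seq I) (P : pred I) (F : I -> fps R) k :
  (\sum_(i <- r | P i) F i) k = \sum_(i <- r | P i) F i k.
Proof. by elim/big_rec2: _ => // i y x _ <-. Qed.

Lemma coef0_fpsM f g : (f * g) 0%N = f 0%N * g 0%N.
Proof. by rewrite coef_fpsM big_ord_recl big_ord0 addr0. Qed.

Lemma coef_fpsCM c f k : (fpsC c * f) k = c * f k.
Proof.
rewrite coef_fpsM big_ord_recl big1 => [|i _]; last by rewrite /= mul0r.
by rewrite /= subn0 addr0.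
Qed.

Let fpsC_additive : zmod_morphism fpsC.
Proof. by move=> x y; apply/fpsP; case=> //= _; rewrite subrr. Qed.
Let fpsC_multiplicative : monoid_morphism fpsC.
Proof.
split=> // x y; apply/fpsP => k; rewrite coef_fpsCM !coef_fpsC.
by case: k => //= k; rewrite mulr0.
Qed.
HB.instance Definition _ :=
  GRing.isZmodMorphism.Build R (fps R) fpsC fpsC_additive.
HB.instance Definition _ :=
  GRing.isMonoidMorphism.Build R (fps R) fpsC fpsC_multiplicative.

Definition fpsX : fps R := Fps (fun k => (k == 1%N)%:R).

Lemma coef0_fpsXM f : (fpsX * f) 0%N = 0.
Proof. by rewrite coef0_fpsM /= mul0r. Qed.

Lemma coefS_fpsXM f k : (fpsX * f) k.+1 = f k.
Proof.
rewrite coef_fpsM big_ord_recl big_ord_recl /= mul0r add0r mul1r subn1 /=.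
by rewrite big1 ?addr0 // => i _; rewrite /= mul0r.
Qed.

Lemma coef_fpsXn n k : (fpsX ^+ n) k = (k == n)%:R.
Proof.
elim: n k => [|n IH] k; first by rewrite expr0 coef_fps1.
by rewrite exprS; case: k => [|k]; rewrite ?coef0_fpsXM // coefS_fpsXM IH eqSS.
Qed.

Lemma fpsX_inj f g : fpsX * f = fpsX * g -> f = g.
Proof. by move=> /fpsP E; apply/fpsP => k; have := E k.+1; rewrite !coefS_fpsXM. Qed.

(** The substitution z |-> a z. *)
Definition dilate (a : R) f : fps R := Fps (fun k => a ^+ k * f k).

Let dilate_additive a : zmod_morphism (dilate a).
Proof. by move=> f g; apply/fpsP => k /=; rewrite mulrBr. Qed.
Let dilate_multiplicative a : monoid_morphism (dilate a).
Proof.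
split=> [|f g]; apply/fpsP => k /=.
  by case: k => [|k] /=; rewrite ?mulr0 ?mulr1.
rewrite mulr_sumr; apply: eq_bigr => i _.
by rewrite mulrACA -exprD subnKC // leq_ord.
Qed.
HB.instance Definition _ a :=
  GRing.isZmodMorphism.Build (fps R) (fps R) (dilate a) (dilate_additive a).
HB.instance Definition _ a :=
  GRing.isMonoidMorphism.Build (fps R) (fps R) (dilate a)
    (dilate_multiplicative a).

Lemma dilateC a c : dilate a (fpsC c) = fpsC c.
Proof. by apply/fpsP => -[|k] /=; rewrite ?mul1r ?mulr0. Qed.

(** The derivation z d/dz. *)
Definition theta f : fps R := Fps (fun k => f k *+ k).

Lemma thetaM f g : theta (f * g) = theta f * g + f * theta g.
Proof.
apply/fpsP => k; rewrite coef_fpsD /= -big_split /= -sumrMnl.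
apply: eq_bigr => i _.
by rewrite mulrnAl mulrnAr -mulrnDr subnKC // leq_ord.
Qed.

Lemma theta1 : theta 1 = 0.
Proof. by apply/fpsP => -[|k] /=; rewrite ?mul0rn. Qed.

Lemma thetaX f n : theta (f ^+ n.+1) = theta f * f ^+ n *+ n.+1.
Proof.
elim: n => [|n IH]; first by rewrite expr1 expr0 mulr1.
rewrite exprS thetaM IH mulrnAr mulrCA -exprS.
by rewrite [in RHS]mulrS.
Qed.

End FpsRing.

Arguments fpsX {R}.

Section FpsMap.
Variables (R S : comNzRingType) (h : {rmorphism R -> S}).
Definition fps_map (f : fps R) : fps S := Fps (fun k => h (f k)).
Lemma fps_mapM f g : fps_map (f * g) = fps_map f * fps_map g.
Proof.
apply/fpsP => k /=; rewrite rmorph_sum; apply: eq_bigr => i _.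
by rewrite rmorphM.
Qed.

End FpsMap.

Section FpsField.
Variable K : fieldType.
Implicit Types f g : fps K.

(** A series is inverted by solving f g = 1 one coefficient at a time. Each new
    coefficient involves all the earlier ones, so the recursion builds the list
    of the first coefficients, the last one being the head. *)
Fixpoint inv_coefs f n : seq K :=
  if n is n'.+1 then
    let s := inv_coefs f n' in
    - (f 0%N)^-1 * (\sum_(i < n') f i.+1 * s`_i - (n' == 0%N)%:R) :: s
  else [::].

Definition fps_inv f : fps K := Fps (fun k => (inv_coefs f k.+1)`_0).

Let nth_inv_coefs f n i : (i < n)%N ->
  (inv_coefs f n)`_i = fps_inv f (n - i.+1)%N.
Proof.
elim: n i => // n IH [|i] ni; first by rewrite subn1.
by rewrite subSS -IH.
Qed.

Lemma fps_invE f k : fps_inv f k =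
  - (f 0%N)^-1 * (\sum_(i < k) f i.+1 * fps_inv f (k - i.+1)%N - (k == 0%N)%:R).
Proof.
rewrite /=; congr (_ * (_ - _)); apply: eq_bigr => i _.
by rewrite nth_inv_coefs.
Qed.

Lemma fps_mulfV f : f 0%N != 0 -> f * fps_inv f = 1.
Proof.
move=> f0; apply/fpsP => k; rewrite coef_fpsM big_ord_recl subn0 fps_invE.
rewrite mulNr mulrN mulVKf // coef_fps1.
under [X in _ + X]eq_bigr do rewrite /= /bump add1n.
by rewrite opprB subrK.
Qed.

End FpsField.

(** * Sine and cosecant as formal series, and the residue formula *)

Section FormalTrigonometry.
Variable K : numFieldType.

Definition fexp (a : K) : fps K := Fps (fun k => a ^+ k / k`!%:R).

Let fact_neq0 k : (k`!)%:R != 0 :> K.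
Proof. by rewrite pnatr_eq0 -lt0n fact_gt0. Qed.

Lemma fexp0 : fexp 0 = 1.
Proof.
by apply/fpsP => -[|k]; rewrite coef_fps1 /= expr0n /= ?divr1 ?mul0r.
Qed.

Lemma fexpD a b : fexp (a + b) = fexp a * fexp b.
Proof.
apply/fpsP => k; rewrite coef_fpsM /= addrC exprDn mulr_suml.
apply: eq_bigr => j _; have jk : (j <= k)%N by rewrite -ltnS.
rewrite [b ^+ _ * _]mulrC -mulr_natr -(bin_fact jk) !natrM.
by field; rewrite !fact_neq0 pnatr_eq0 -lt0n bin_gt0 jk.
Qed.

Lemma fexpNK a : fexp a * fexp (- a) = 1.
Proof. by rewrite -fexpD subrr fexp0. Qed.

Lemma dilate_fexp b a : dilate b (fexp a) = fexp (b * a).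
Proof. by apply/fpsP => k /=; rewrite exprMn mulrA. Qed.

Lemma fexpX a n : fexp a ^+ n = fexp (a *+ n).
Proof. by elim: n => [|n IH]; rewrite ?fexp0 // exprS IH -fexpD -mulrS. Qed.

(* iu is the imaginary unit. *)
Variable iu : K.
Hypothesis iu2 : iu * iu = -1.

Let iu_neq0 : iu != 0.
Proof.
by apply/eqP => i0; move/eqP: iu2; rewrite i0 mul0r eq_sym oppr_eq0 oner_eq0.
Qed.

Definition fsin : fps K := fpsC (2 * iu)^-1 * (fexp iu - fexp (- iu)).
Definition fcos : fps K := fpsC 2^-1 * (fexp iu + fexp (- iu)).
Definition fsinc : fps K :=
  Fps (fun k => (iu ^+ k.+1 - (- iu) ^+ k.+1) / (2 * iu * k.+1`!%:R)).

Lemma fpsX_fsinc : fpsX * fsinc = fsin.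
Proof.
apply/fpsP => -[|k]; rewrite coef_fpsCM coef_fpsD coef_fpsN.
  by rewrite coef0_fpsXM /= subrr mulr0.
by rewrite coefS_fpsXM /=; field; rewrite iu_neq0 fact_neq0.
Qed.

Lemma fcosE : fcos = fsinc + theta fsinc.
Proof.
apply/fpsP => k; rewrite coef_fpsCM !coef_fpsD /= -mulrS -[RHS]mulr_natr.
rewrite factS natrM !exprS.
by field; rewrite iu_neq0 fact_neq0 -(natrD _ 1) pnatr_eq0.
Qed.

Lemma fcos2Dfsin2 : fcos ^+ 2 + fsin ^+ 2 = 1.
Proof.
rewrite /fcos /fsin !exprMn -!rmorphXn /=.
have -> : fpsC ((2 * iu)^-1 ^+ 2) = - fpsC (2^-1 ^+ 2 : K).
  rewrite -rmorphN /=; congr fpsC.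
  have -> : (2 * iu)^-1 ^+ 2 = (4 * (iu * iu))^-1 by field; rewrite iu_neq0.
  by rewrite iu2; field.
have -> : fpsC (2^-1 ^+ 2 : K) * (fexp iu + fexp (- iu)) ^+ 2 +
  - fpsC (2^-1 ^+ 2) * (fexp iu - fexp (- iu)) ^+ 2 =
  fpsC (2^-1 ^+ 2) * 4 * (fexp iu * fexp (- iu)) by ring.
rewrite fexpNK mulr1 -(rmorph_nat (@fpsC K)) -rmorphM -[RHS](rmorph1 (@fpsC K)).
by congr fpsC; field.
Qed.

Lemma coef0_fsinc : fsinc 0%N = 1.
Proof. by rewrite /= !expr1 (_ : 1`! = 1)%N //; field. Qed.

Lemma dilateN1_fsinc : dilate (-1) fsinc = fsinc.
Proof.
apply/fpsP => k /=; rewrite mulrA; congr (_ / _).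
have := sqrr_sign K k; rewrite [(- iu) ^+ _]exprNn [(-1) ^+ k.+1]exprS.
move: ((-1) ^+ k) => e e2; have {e2} : e * e = 1 by rewrite -expr2.
move: (iu ^+ k.+1) => p e2; transitivity (e * p + e * e * p); first by ring.
by rewrite e2; ring.
Qed.

(** The series z / sin z. *)
Definition fxcsc : fps K := fps_inv fsinc.

Lemma fsinc_fxcsc : fsinc * fxcsc = 1.
Proof. by apply: fps_mulfV; rewrite coef0_fsinc oner_neq0. Qed.

Lemma coef0_fxcsc : fxcsc 0%N = 1.
Proof.
have /fpsP/(_ 0%N) := fsinc_fxcsc.
by rewrite coef0_fpsM coef0_fsinc mul1r => ->.
Qed.

Lemma fxcsc_uniq f : fsinc * f = 1 -> f = fxcsc.
Proof.
move=> E; rewrite -[f]mul1r -fsinc_fxcsc mulrAC.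
by rewrite E mul1r.
Qed.

Lemma dilateN1_fxcsc : dilate (-1) fxcsc = fxcsc.
Proof.
apply: fxcsc_uniq; rewrite -[X in X * _]dilateN1_fsinc -rmorphM fsinc_fxcsc.
exact: rmorph1.
Qed.

(** z / sin z is even. *)
Lemma coef_odd_fxcscX n k : odd k -> (fxcsc ^+ n) k = 0.
Proof.
move=> k_odd; have : dilate (-1) (fxcsc ^+ n) = fxcsc ^+ n.
  by rewrite rmorphXn /= dilateN1_fxcsc.
move=> /fpsP/(_ k) /=; rewrite -signr_odd k_odd mulN1r => /eqP.
by rewrite eq_sym -addr_eq0 -mulr2n mulrn_eq0 => /eqP.
Qed.

(** The residue at 0 of cos z / sin^{k+1} z, the derivative of
    - sin^{-k} z / k when k > 0: only the logarithmic case k = 0 contributes. *)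
Lemma coef_fcos_fxcscX k : (0 < k)%N -> (fcos * fxcsc ^+ k.+1) k = 0.
Proof.
case: k => // k _; set f := fxcsc.
have Ef : fsinc * f = 1 := fsinc_fxcsc.
have theta_f : theta f = - theta fsinc * f ^+ 2.
  have : theta (fsinc * f) = 0 by rewrite Ef theta1.
  rewrite thetaM => /(congr1 ( *%R f)).
  have -> : f * (theta fsinc * f + fsinc * theta f) =
            theta fsinc * f ^+ 2 + fsinc * f * theta f by ring.
  by rewrite Ef mul1r mulr0 addrC => /eqP; rewrite addr_eq0 mulNr => /eqP.
have -> : fcos * f ^+ k.+2 = f ^+ k.+1 - theta f * f ^+ k.
  rewrite fcosE theta_f !exprS.
  transitivity (fsinc * f * (f * f ^+ k) + theta fsinc * f * f * f ^+ k).
    by ring.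
  by rewrite Ef; ring.
rewrite coef_fpsD coef_fpsN.
have /fpsP/(_ k.+1) := thetaX f k; rewrite coef_fpsMn [LHS]/= => /eqP.
by rewrite eqrMn2r => /eqP ->; rewrite subrr.
Qed.

(** The series in z of sin (x - z), where s = sin x and c = cos x. *)
Definition fsinB (s c : K) : fps K := fpsC s * fcos - fpsC c * fsin.
Definition fcscB (s c : K) : fps K := fps_inv (fsinB s c).

Lemma coef0_fsinB s c : fsinB s c 0%N = s.
Proof.
rewrite /fsinB /fcos /fsin coef_fpsD coef_fpsN !coef_fpsCM !coef_fpsD coef_fpsN.
by rewrite /= fact0 !expr0 !divr1 subrr !mulr0; field.
Qed.

Lemma fsinB_fcscB s c : s != 0 -> fsinB s c * fcscB s c = 1.
Proof. by move=> s0; apply: fps_mulfV; rewrite coef0_fsinB. Qed.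

(** The residue at 0 of csc (x - z) / sin^N z is csc^N x for odd N. From
    sin^2 x - sin^2 z = sin (x - z) sin (x + z) one gets
    sin^2 x csc (x - z) = sin (x + z) + sin^2 z csc (x - z), so that, for
    N > 1, going from N to N - 2 divides the residue by csc^2 x. *)
Lemma coef_fcscB_fxcscX s c n : s != 0 -> s ^+ 2 + c ^+ 2 = 1 ->
  (fcscB s c * fxcsc ^+ n.*2.+1) n.*2 = s^-1 ^+ n.*2.+1.
Proof.
move=> s0 sc; have csc_sin := fsinB_fcscB c s0.
set f := fcscB s c in csc_sin *; set g := fxcsc.
have Eg : fsinc * g = 1 := fsinc_fxcsc.
elim: n => [|n IH].
  rewrite double0 !expr1 coef0_fpsM coef0_fxcsc mulr1.
  have /fpsP/(_ 0%N) := csc_sin.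
  rewrite coef0_fpsM coef0_fsinB coef_fps1 /= => sf.
  by rewrite -[LHS](mulKf s0) sf mulr1.
(* Multiplied by g ^+ N, the powers of fpsX * fsinc leave powers of fpsX. *)
have E : fpsC s ^+ 2 * f =
    fpsC s * fcos + fpsC c * (fpsX * fsinc) + (fpsX * fsinc) ^+ 2 * f.
  rewrite fpsX_fsinc.
  have -> : fpsC s ^+ 2 = fsinB s c * (fpsC s * fcos + fpsC c * fsin)
                          + fsin ^+ 2.
    have c2 : fpsC c ^+ 2 = 1 - fpsC s ^+ 2.
      by rewrite -!rmorphXn -(rmorph1 (@fpsC K)) -rmorphB /= -sc addrC addKr.
    have C2 : fcos ^+ 2 = 1 - fsin ^+ 2 by rewrite -fcos2Dfsin2 addrK.
    transitivity (fpsC s ^+ 2 * fcos ^+ 2 - fpsC c ^+ 2 * fsin ^+ 2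
                  + fsin ^+ 2); last by rewrite /fsinB; ring.
    by rewrite C2 c2; ring.
  transitivity (fsinB s c * f * (fpsC s * fcos + fpsC c * fsin) + fsin ^+ 2 * f).
    by ring.
  by rewrite csc_sin mul1r.
apply: (mulfI (expf_neq0 2 s0)); rewrite doubleS.
rewrite -coef_fpsCM rmorphXn mulrA E.
have -> : (fpsC s * fcos + fpsC c * (fpsX * fsinc) + (fpsX * fsinc) ^+ 2 * f)
    * g ^+ n.*2.+3 = fpsC s * (fcos * g ^+ n.*2.+3)
      + (fpsC c * (fpsX * (g ^+ n.*2.+2)) + fpsX * (fpsX * (f * g ^+ n.*2.+1))).
  rewrite [g ^+ n.*2.+3]exprS ![g ^+ n.*2.+2]exprS.
  move: (g ^+ n.*2.+1) => P.
  transitivity (fpsC s * (fcos * (g * (g * P)))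
      + fpsC c * (fpsX * ((fsinc * g) * (g * P)))
      + fpsX * (fpsX * (f * ((fsinc * g) ^+ 2 * P)))); first by ring.
  by rewrite Eg expr1n !mul1r addrA.
have coefE (u v w : fps K) k :
    (fpsC s * u + (fpsC c * (fpsX * v) + fpsX * (fpsX * w))) k.+2
    = s * u k.+2 + (c * v k.+1 + w k).
  by rewrite 2!coef_fpsD !coef_fpsCM !coefS_fpsXM.
rewrite coefE coef_fcos_fxcscX // coef_odd_fxcscX; last first.
  by rewrite /= odd_double.
rewrite !mulr0 !add0r IH -[n.*2.+3]/(2 + n.*2.+1)%N exprD.
by move: (s^-1 ^+ n.*2.+1) => P; field.
Qed.

End FormalTrigonometry.

(** * Convergent power series and their reciprocals *)

Section PowerSeries.
Variable K : numFieldType.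
Local Open Scope classical_set_scope.
Implicit Types (a b : nat -> K) (f g : fps K).

Lemma norm_geometric_tail a (M q : K) m n : 0 <= M -> 0 <= q <= 2^-1 ->
  (forall k, `|a k| <= M * q ^+ k) ->
  `|\sum_(m <= k < n) a k| <= 2 * M * q ^+ m.
Proof.
move=> M0 /andP[q0 q2] aM.
have [nm|/ltnW mn] := leqP n m.
  by rewrite big_geq // normr0 !mulr_ge0 // exprn_ge0.
suff : `|\sum_(m <= k < n) a k| <= 2 * M * (q ^+ m - q ^+ n).
  move=> /le_trans; apply; rewrite ler_wpM2l ?mulr_ge0 //.
  by rewrite lerBlDr lerDl exprn_ge0.
elim: n mn => [|n IH].
  by rewrite leqn0 => /eqP ->; rewrite big_geq // normr0 subrr mulr0.
rewrite leq_eqVlt => /predU1P[<-|mn]; first by rewrite big_geq // normr0 subrr mulr0.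
rewrite big_nat_recr //= (le_trans (ler_normD _ _)) //.
rewrite (le_trans (lerD (IH mn) (aM n))) // exprS.
rewrite -subr_ge0 (_ : _ - _ = 2 * M * q ^+ n * (2^-1 - q)); last by field.
by rewrite !mulr_ge0 ?subr_ge0 // exprn_ge0.
Qed.

(** The lowest nonzero term of a power series dominates the others near 0. *)
Lemma power_series_eq0 a (e : K) : 0 < e ->
  (forall z, z != 0 -> `|z| < e -> series (fun k => a k * z ^+ k) @ \oo --> 0) ->
  forall k, a k = 0.
Proof.
move=> e0 a0 p; elim/ltn_ind: p => p IH; apply/eqP/negP => /negP ap.
pose w := e / 2; have w0 : 0 < w by rewrite divr_gt0.
have we : w < e by rewrite ltr_pdivrMr // mulr_natr mulr2n ltrDr.
have : series (fun k => a k * w ^+ k) @ \oo --> 0.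
  by apply: a0; rewrite ?gt_eqF // gtr0_norm.
move=> cvw; have {cvw} : cvgn (series (fun k => a k * w ^+ k)) by apply/cvg_ex; exists 0.
move=> /cvg_series_cvg_0 cvw.
have {cvw} : cvgn (fun k => a k * w ^+ k : K) by apply/cvg_ex; exists 0.
move=> /cvg_seq_bounded/pinfty_ex_gt0[M M_gt0 /= aM].
pose X := `|a p * w ^+ p|.
have X0 : 0 < X by rewrite normr_gt0 mulf_neq0 // expf_neq0 // gt_eqF.
have MX : 0 < 4 * M + 4 * X by rewrite addr_gt0 // mulr_gt0.
(* At q w the terms after the p-th add up to at most 2 M q^(p+1), and this q
   makes it at most half of the p-th term X q^p. *)
pose q := X / (4 * M + 4 * X); have q0 : 0 < q by rewrite divr_gt0.
have q4 : q <= 4^-1.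
  rewrite ler_pdivrMr // mulrDr !mulKf ?pnatr_eq0 // lerDr ltW //.
have q1 : q <= 2^-1 by rewrite (le_trans q4) // lef_pV2 ?posrE // ler_nat.
have qw0 : 0 < q * w by rewrite mulr_gt0.
have : series (fun k => a k * (q * w) ^+ k) @ \oo --> 0.
  apply: a0; rewrite ?gt_eqF // gtr0_norm // (le_lt_trans _ we) //.
  by rewrite ler_piMl ?ltW // (le_lt_trans q1) // invf_lt1 // ltr1n.
move=> /cvgr0_norm_lt /(_ (X * q ^+ p / 2)).
case=> [|N _ /(_ (maxn N p.+1))]; first by rewrite divr_gt0 // mulr_gt0 // exprn_gt0.
rewrite /= leq_maxl => /(_ isT); set n := maxn _ _ => small.
have pn : (p < n)%N by rewrite leq_maxr.
have bound k : `|a k * (q * w) ^+ k| <= M * q ^+ k.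
  rewrite exprMn [q ^+ k * _]mulrC mulrA normrM [`|q ^+ k|]ger0_norm.
    by rewrite ler_wpM2r ?exprn_ge0 ?(ltW q0) // aM.
  by rewrite exprn_ge0 // ltW.
have tail := @norm_geometric_tail _ M q p.+1 n (ltW M_gt0) _ bound.
have {}tail := tail (introT andP (conj (ltW q0) q1)).
have split_series : series (fun k => a k * (q * w) ^+ k) n =
    a p * (q * w) ^+ p + \sum_(p.+1 <= k < n) a k * (q * w) ^+ k.
  rewrite /series /= (big_cat_nat _ (ltnW pn)) //= big_nat big1 ?add0r.
    by rewrite big_ltn.
  by move=> k /andP[_ kp]; rewrite IH // mul0r.
have : X * q ^+ p < X * q ^+ p.
  rewrite {1}/X -{1}[q ^+ p]ger0_norm ?exprn_ge0 ?(ltW q0) // -normrM.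
  rewrite -mulrA -exprMn [w * q]mulrC.
  rewrite -[a p * _](addrK (\sum_(p.+1 <= k < n) a k * (q * w) ^+ k)).
  rewrite -split_series (le_lt_trans (ler_normB _ _)) //.
  rewrite [ltRHS](splitr (X * q ^+ p)) ltr_leD // (le_trans tail) //.
  rewrite exprS mulrA [X * _ / 2]mulrAC ler_wpM2r ?exprn_ge0 ?(ltW q0) //.
  rewrite -subr_ge0 (_ : _ - _ = 2 * (X * X) / (4 * M + 4 * X)).
    by rewrite !mulr_ge0 ?invr_ge0 // ltW.
  by rewrite /q; field; rewrite gt_eqF.
by rewrite ltxx.
Qed.

Lemma is_egf_uniq a b (f : K -> K) : is_egf a f -> is_egf b f -> a = b.
Proof.
move=> af bf; apply/funext => k.
have /nbhs_ballP[e /= e0 abf] : \forall z \near (0 : K)^',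
    series (fun k => a k / k`!%:R * z ^+ k) @ \oo --> f z /\
    series (fun k => b k / k`!%:R * z ^+ k) @ \oo --> f z.
  by near=> z; split; near: z.
have /power_series_eq0 : forall z : K, z != 0 -> `|z| < e ->
    series (fun k => (a k - b k) / k`!%:R * z ^+ k) @ \oo --> 0.
  move=> z z0 ze; have [|az bz] := abf z _ z0.
    by rewrite /ball /= sub0r normrN.
  rewrite -(subrr (f z)).
  rewrite [X in X @ _](_ : _ = (fun n =>
      series (fun k => a k / k`!%:R * z ^+ k) n -
      series (fun k => b k / k`!%:R * z ^+ k) n)); first exact: cvgB.
  apply/funext => n; rewrite /series /= -sumrB.
  by apply: eq_bigr => i _; rewrite !mulrBl.
move=> /(_ e0 k)/eqP; rewrite mulf_eq0 invr_eq0 pnatr_eq0.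
by rewrite -[_`! == _]negbK -lt0n fact_gt0 orbF subr_eq0 => /eqP.
Unshelve. all: by end_near. Qed.

(** The difference is the sum over i < n of f_i times a tail of g starting at
    n - i. Each of these n <= 2^n terms has size at most 2 M N / 4^n. That 2^-n
    tends to 0 has to be assumed, as a numeric field need not be
    archimedean. *)
Lemma cauchy_product_cvg f g (M N : K) : 0 <= M -> 0 <= N ->
  (forall k, `|f k| <= M * 4^-1 ^+ k) -> (forall k, `|g k| <= N * 4^-1 ^+ k) ->
  (fun n => 2^-1 ^+ n : K) @ \oo --> 0 ->
  (fun n => series f n * series g n - series (f * g) n) @ \oo --> 0.
Proof.
move=> M0 N0 fM gN half0.
have prodE n : series (f * g) n = \sum_(i < n) f i * series g (n - i)%N.
  elim: n => [|n IH]; first by rewrite /series /= big_geq // big_ord0.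
  rewrite seriesSr IH coef_fpsM [in RHS]big_ord_recr [in LHS]big_ord_recr /=.
  rewrite subSnn subnn [series g 1%N]seriesSr [series g 0%N]big_geq // add0r.
  rewrite addrA; congr (_ + _); rewrite -big_split /=; apply: eq_bigr => i _.
  by rewrite -mulrDr subSn ?seriesSr // ltnW.
have bound n : `|series f n * series g n - series (f * g) n| <=
    2 * M * N * 2^-1 ^+ n.
  rewrite prodE {1}/series /= big_mkord mulr_suml -sumrB.
  rewrite (le_trans (ler_norm_sum _ _ _)) //.
  have le_term (i : 'I_n) : true ->
      `|f i * series g n - f i * series g (n - i)%N| <= 2 * M * N * 4^-1 ^+ n.
    move=> _; rewrite -mulrBr normrM sub_series_geq ?leq_subr //.
    rewrite (_ : 2 * M * N * _ = (M * 4^-1 ^+ i) * (2 * N * 4^-1 ^+ (n - i))).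
      apply: ler_pM => //; apply: norm_geometric_tail => //.
      by rewrite invr_ge0 ler0n lef_pV2 ?posrE // ler_nat.
    rewrite -{1}(subnKC (ltnW (ltn_ord i))) exprD.
    by ring.
  rewrite (le_trans (ler_sum _ le_term)) // sumr_const card_ord.
  rewrite -[_ *+ n]mulr_natr -[2 * M * N * _ * _]mulrA ler_wpM2l ?mulr_ge0 //.
  rewrite (_ : 4^-1 = 2^-1 * 2^-1 :> K); last by field.
  rewrite exprMn -mulrA ler_piMr ?exprn_ge0 // exprVn mulrC.
  rewrite ler_pdivrMr ?exprn_gt0 // mul1r -natrX ler_nat.
  exact/ltnW/ltn_expl.
apply/norm_cvg0P; apply/cvgr0Pnorm_lt => /= e e0.
have c0 : 0 < 2 * M * N + 1.
  by rewrite ltr_wpDl // !mulr_ge0.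
have /cvgr0_norm_lt/(_ (e / (2 * M * N + 1))) := half0.
move=> /(_ _)[|m _ H]; first by rewrite divr_gt0.
exists m => // n mn; rewrite normr_id (le_lt_trans (bound n)) //.
have := H n mn; rewrite /= ger0_norm ?exprn_ge0 // ltr_pdivlMr // => h.
rewrite (le_lt_trans _ h) // [leRHS]mulrC ler_wpM2r ?exprn_ge0 //.
by rewrite lerDl.
Qed.

(** The recursion bounds each coefficient of the inverse by a constant times
    the sum of the previous ones, hence a geometric growth. *)
Lemma norm_fps_inv_le g (M : K) : (forall k, `|g k| <= M) ->
  forall k, `|fps_inv g k| <= `|g 0%N|^-1 * (1 + `|g 0%N|^-1 * M) ^+ k.
Proof.
move=> gM; have M0 : 0 <= M by rewrite (le_trans _ (gM 0%N)).
set c := `|g 0%N|^-1; have c0 : 0 <= c by rewrite invr_ge0.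
set q := 1 + c * M; have q0 : 0 <= q by rewrite addr_ge0 ?mulr_ge0.
elim/ltn_ind => -[|k] IH.
  rewrite fps_invE big_ord0 expr0 mulr1 sub0r mulrNN mulr1.
  by rewrite normfV.
rewrite fps_invE subr0 normrM normrN normfV -/c ler_wpM2l //.
rewrite (le_trans (ler_norm_sum _ _ _)) //.
have le_term (i : 'I_k.+1) : true ->
    `|g i.+1 * fps_inv g (k.+1 - i.+1)%N| <= M * (c * q ^+ (k - i)).
  move=> _; rewrite normrM subSS; apply: ler_pM => //.
  by apply: IH; rewrite ltnS leq_subr.
rewrite (le_trans (ler_sum _ le_term)) // -!mulr_sumr.
rewrite (reindex_inj rev_ord_inj) /=.
under eq_bigr => i _ do rewrite subSS subKn ?leq_ord //.
rewrite mulrA -[M * c]mulrC (_ : c * M = q - 1); last by rewrite /q addrC addKr.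
by rewrite -subrX1 lerBlDr lerDl.
Qed.

(** The reciprocal of the sum of a power series is the sum of the formal
    inverse: the Cauchy product of the two series is 1, so their partial sums
    have product tending to 1. This also excludes a zero value, because the
    partial sums of the inverse stay bounded. *)
Lemma is_egf_inv g (M : K) (f : K -> K) : (fun n => 2^-1 ^+ n : K) @ \oo --> 0 ->
  g 0%N != 0 -> (forall k, `|g k| <= M) ->
  (\forall z \near (0 : K)^', series (dilate z g) @ \oo --> (f z)^-1) ->
  is_egf (fun k => fps_inv g k * k`!%:R) f.
Proof.
move=> half0 g0 gM gf.
have M0 : 0 <= M by rewrite (le_trans _ (gM 0%N)).
pose c := `|g 0%N|^-1; have c0 : 0 <= c by rewrite invr_ge0.
pose q := 1 + c * M; have q1 : 1 <= q by rewrite lerDl mulr_ge0.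
have q0 : 0 < q by rewrite (lt_le_trans _ q1).
have q4 : 0 < (4 * q)^-1 by rewrite invr_gt0 mulr_gt0.
rewrite /is_egf; near=> z.
have zq : `|z| <= (4 * q)^-1 by near: z; apply: dnbhs0_le.
have gz : series (dilate z g) @ \oo --> (f z)^-1 by near: z.
have z4 : `|z| <= 4^-1.
  by rewrite (le_trans zq) // lef_pV2 ?posrE ?mulr_gt0 // ler_pMr.
have dg k : `|dilate z g k| <= M * 4^-1 ^+ k.
  rewrite /= normrM normrX mulrC ler_pM ?exprn_ge0 //.
  by rewrite lerXn2r ?nnegrE ?invr_ge0.
have di k : `|dilate z (fps_inv g) k| <= c * 4^-1 ^+ k.
  rewrite /= normrM normrX mulrC.
  rewrite (le_trans (ler_wpM2r _ (norm_fps_inv_le gM k))) ?exprn_ge0 //.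
  rewrite -mulrA ler_wpM2l // -exprMn lerXn2r ?nnegrE ?mulr_ge0 ?invr_ge0 //.
    exact: ltW.
  rewrite -/c -/q mulrC -ler_pdivlMr //.
  by rewrite -invfM.
have -> : (fun k => fps_inv g k * k`!%:R / k`!%:R * z ^+ k) =
    dilate z (fps_inv g).
  apply/funext => k; rewrite mulfK; first by rewrite mulrC.
  by rewrite pnatr_eq0 -lt0n fact_gt0.
have /cvgrPdist_lt prod := cauchy_product_cvg M0 c0 dg di half0.
have inv_bounded n : `|series (dilate z (fps_inv g)) n| <= 2 * c.
  rewrite -[leRHS]mulr1 -(expr0 4^-1) /series /=.
  apply: norm_geometric_tail => //.
  by rewrite invr_ge0 ler0n lef_pV2 ?posrE // ler_nat.
have one : (fun n => series (dilate z g) n * series (dilate z (fps_inv g)) n)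
    @ \oo --> (1 : K).
  apply/cvgrPdist_lt => e e0; have [m _ H] := prod e e0.
  exists m.+1 => //= n mn; have := H n (ltnW mn).
  rewrite -rmorphM fps_mulfV // rmorph1 sub0r normrN.
  have -> : series (1 : fps K) n = 1; last by rewrite distrC.
  case: n mn => // n _; rewrite /series /= big_ltn // big_nat big1 ?addr0 //.
  by case.
have fz : (f z)^-1 != 0.
  apply/eqP => f0; rewrite f0 in gz.
  have : (1 : K) = 0.
    refine (@norm_cvg_unique K K _ _ _ _ one _).
    apply/cvgrPdist_lt => e e0.
    have c1 : 0 < 2 * c + 1 by rewrite ltr_wpDl // mulr_ge0.
    have /cvgr0_norm_lt/(_ (e / (2 * c + 1))) := gz.
    case=> [|m _ H]; first by rewrite divr_gt0.
    exists m => // n mn; rewrite sub0r normrN normrM.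
    have := H n mn; rewrite /= ltr_pdivlMr //; apply: le_lt_trans.
    rewrite ler_wpM2l // (le_trans (inv_bounded n)) //.
    by rewrite lerDl.
  by move/eqP; rewrite oner_eq0.
have : (fun n => (series (dilate z g) n * series (dilate z (fps_inv g)) n)
        * (series (dilate z g) n)^-1) @ \oo --> f z.
  by rewrite -[f z]invrK -[X in _ --> X]mul1r; apply: cvgM => //; apply: cvgV.
apply: cvg_trans; apply: near_eq_cvg.
have : \forall n \near \oo, series (dilate z g) n != 0.
  have /cvgrPdist_lt/(_ `|(f z)^-1|) := gz.
  case=> [|m _ H]; first by rewrite normr_gt0.
  exists m => // n mn; apply/eqP => s0; have := H n mn.
  by rewrite /= s0 subr0 ltxx.
by apply: filterS => n sn; rewrite mulrAC mulfV // mul1r.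
Unshelve. all: by end_near. Qed.
End PowerSeries.

(** * The complex exponential series *)

Section ComplexExponential.
Variable R : realType.
Local Open Scope classical_set_scope.
(* Convergence in R[i] is for the norm topology of numeric fields. *)
Let C : numFieldType := R[i].
Implicit Types (x y : R) (z : C).

Lemma normc_real x : `|x%:C| = `|x|%:C.
Proof. by rewrite normc_def /= expr0n /= addr0 sqrtr_sqr. Qed.

Lemma normc_imag y : `|'i%C * y%:C| = `|y|%:C.
Proof.
by rewrite normc_def /= !mul0r mulr0 mul1r subr0 expr0n /= !add0r sqrtr_sqr.
Qed.

Lemma cvg_real_complex (u : nat -> R) (l : R) :
  u @ \oo --> l -> (fun n => (u n)%:C : C) @ \oo --> (l%:C : C).
Proof.
move=> /cvgrPdist_lt ul; apply/cvgrPdist_lt => e e0.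
have er : (complex.Re e)%:C = e by rewrite RRe_real // gtr0_real.
have Re0 : 0 < complex.Re e by rewrite -ltcR er.
have [m _ H] := ul _ Re0; exists m => // n mn.
by rewrite -rmorphB normc_real -er ltcR; exact: H.
Qed.

Lemma cvg_half : (fun n => 2^-1 ^+ n : R) @ \oo --> 0.
Proof.
by apply: cvg_expr; rewrite gtr0_norm ?invr_gt0 // invf_lt1 // ltr1n.
Qed.

Lemma cvg_halfc : (fun n => 2^-1 ^+ n : C) @ \oo --> 0.
Proof.
have := cvg_real_complex cvg_half; rewrite rmorph0.
by under eq_fun do rewrite rmorphXn fmorphV rmorph_nat.
Qed.

Lemma cvg_series_fexp x : series (fexp x) @ \oo --> expR x.
Proof. exact: is_cvg_series_exp_coeff. Qed.

Lemma norm_fexp_geometric x :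
  exists2 M : R, 0 <= M & forall k, `|fexp x k| <= M * 4^-1 ^+ k.
Proof.
have : cvgn (exp_coeff (4 * x)) by apply/cvg_ex; exists 0; exact: cvg_exp_coeff.
move=> /cvg_seq_bounded/pinfty_ex_gt0[M M_gt0 /= xM].
exists M => [|k]; first exact: ltW.
have := xM k I; rewrite /exp_coeff /= exprMn -mulrA normrM normrX ger0_norm //.
by rewrite exprVn ler_pdivlMr ?exprn_gt0 // mulrC.
Qed.

Lemma norm_fexp_geometricc z x : `|z| = `|x|%:C ->
  exists2 M : C, 0 <= M & forall k, `|fexp z k| <= M * 4^-1 ^+ k.
Proof.
move=> zx; have [M M0 H] := norm_fexp_geometric x.
exists (M%:C : C) => [|k]; first by rewrite ler0c.
have -> : `|fexp z k| = `|fexp x k|%:C.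
  rewrite /= !normrM !normrX !normfV zx !normr_nat.
  by rewrite rmorphM fmorphV rmorph_nat rmorphXn.
have : `|fexp x k|%:C <= (M * 4^-1 ^+ k)%:C by rewrite lecR.
by rewrite rmorphM rmorphXn fmorphV rmorph_nat.
Qed.

Lemma fexp_imag y k :
  fexp ('i%C * y%:C) k = (cos_coeff y k)%:C + 'i%C * (sin_coeff y k)%:C.
Proof.
rewrite /fexp /cos_coeff /sin_coeff /= exprMn.
have -> : 'i%C ^+ k = ((~~ odd k)%:R * (-1) ^+ k./2
    + 'i%C * ((odd k)%:R * (-1) ^+ k.-1./2)) :> R[i].
  rewrite -{1}(odd_double_half k) exprD -mul2n exprM sqr_i.
  case k_odd : (odd k); rewrite ?expr1 ?expr0 /= !mul1r !mul0r ?mulr0 ?addr0 ?add0r //.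
  congr (_ * _ ^+ _); rewrite -{2}(odd_double_half k) k_odd /=.
  by rewrite (half_bit_double _ false).
rewrite !rmorphM !fmorphV !rmorph_nat !rmorphXn !rmorphN1 /=.
by rewrite mulrDl mulrDl !mulrA.
Qed.

Let eq_cvg_to (u v : nat -> C) (l : C) :
  u =1 v -> u @ \oo --> l -> v @ \oo --> l.
Proof. by move=> /funext ->. Qed.

(** The series of e^(x + i y) is the Cauchy product of those of e^x and
    e^(i y). *)
Lemma cvg_series_fexpc z : series (fexp z) @ \oo --> (cexp z : C).
Proof.
have cvx : series (fexp ((complex.Re z)%:C : C)) @ \oo --> ((expR (complex.Re z))%:C : C).
  apply: (eq_cvg_to _ (cvg_real_complex (@cvg_series_fexp (complex.Re z)))) => n.
  rewrite /series /= rmorph_sum.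
  apply: eq_bigr => k _; rewrite /= rmorphM fmorphV rmorph_nat.
  by rewrite rmorphXn.
have cvy : series (fexp ('i%C * (complex.Im z)%:C : C)) @ \oo -->
    (cos (complex.Im z) +i* sin (complex.Im z) : C).
  set y := complex.Im z.
  have cc : (fun n => (series (cos_coeff y) n)%:C : C) @ \oo --> ((cos y)%:C : C).
    by apply: cvg_real_complex; rewrite unlock; exact: is_cvg_series_cos_coeff.
  have cs : (fun n => (series (sin_coeff y) n)%:C : C) @ \oo --> ((sin y)%:C : C).
    by apply: cvg_real_complex; rewrite unlock; exact: is_cvg_series_sin_coeff.
  rewrite (_ : cos y +i* _ = (cos y)%:C + 'i%C * (sin y)%:C); last first.
    exact: complexE.
  have cis := cvgD cc (cvgM (cvg_cst ('i%C : C)) cs).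
  apply: (eq_cvg_to _ (cis _ _ _)) => n.
  transitivity (\sum_(0 <= k < n) (cos_coeff y k)%:C +
      'i%C * \sum_(0 <= k < n) (sin_coeff y k)%:C : C).
    by rewrite -!rmorph_sum.
  rewrite mulr_sumr -big_split; apply: eq_bigr => k _.
  by rewrite fexp_imag.
have [M M0 Mx] := norm_fexp_geometricc (normc_real (complex.Re z)).
have [N N0 Ny] := norm_fexp_geometricc (normc_imag (complex.Im z)).
have prod := cvgB (cvgM cvx cvy) (cauchy_product_cvg M0 N0 Mx Ny cvg_halfc).
rewrite -[cexp z]subr0; apply: (eq_cvg_to _ (prod _ _)) => n.
by rewrite !fctE opprB addrC subrK -fexpD -complexE.
Qed.

End ComplexExponential.

(** * The numbers A and G as coefficients of formal series *)

Section Coefficients.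
Local Open Scope classical_set_scope.

(** Existence and uniqueness of the expansion turn the choice made by egf_coef
    into an algebraic characterization: the coefficients of a reciprocal form
    the inverse in the ring of formal series. *)
Lemma egf_coef_inv (K : numFieldType) (g : fps K) (M : K) (f : K -> K) :
  (fun n => 2^-1 ^+ n : K) @ \oo --> 0 ->
  g 0%N != 0 -> (forall k, `|g k| <= M) ->
  (\forall z \near (0 : K)^', series (dilate z g) @ \oo --> (f z)^-1) ->
  g * Fps (fun k => egf_coef f k / k`!%:R) = 1.
Proof.
move=> half0 g0 gM gf.
have inv_f := is_egf_inv half0 g0 gM gf.
have -> : egf_coef f = fun k => fps_inv g k * k`!%:R.
  apply: (is_egf_uniq _ inv_f); rewrite /egf_coef.
  refine (@xgetI _ (fun=> 0) [set a | is_egf a f] _ inv_f).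
rewrite -[RHS](fps_mulfV g0); congr (g * _); apply/fpsP => k.
by rewrite [LHS]/= mulfK // pnatr_eq0 -lt0n fact_gt0.
Qed.

Lemma norm_invfact_le1 (K : numFieldType) k : `|(k`!%:R)^-1 : K| <= 1.
Proof. by rewrite normfV normr_nat invf_le1 ?ltr0n ?ler1n ?fact_gt0. Qed.

Variable R : realType.
Let C : numFieldType := R[i].

Definition egf_A (t : C) : fps C := Fps (fun k => A k t / k`!%:R).

Lemma egf_AP (t : C) : t != 1 -> (fpsC t * fexp 1 - 1) * egf_A t = 1.
Proof.
move=> t1; pose g : fps C := fpsC t * fexp 1 - 1.
have gE k : g k = t * (k`!%:R)^-1 - (k == 0%N)%:R.
  by rewrite coef_fpsD coef_fpsN coef_fpsCM coef_fps1 /= expr1n mul1r.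
apply: (@egf_coef_inv C g (`|t| + 1)).
- exact: cvg_halfc.
- by rewrite gE divr1 subr_eq0.
- move=> k; rewrite gE (le_trans (ler_normB _ _)) // lerD //.
    by rewrite normrM ler_piMr // norm_invfact_le1.
  by rewrite normr_nat lern1 leq_b1.
- near=> z; rewrite invrK.
  have dz n : series (dilate z g) n.+1 = t * series (fexp z) n.+1 - 1.
    have -> : dilate z g = fpsC t * fexp z - 1.
      by rewrite /g rmorphB rmorphM rmorph1 /= dilateC dilate_fexp mulr1.
    transitivity (\sum_(0 <= k < n.+1) (t * fexp z k - (1 : fps C) k)).
      by apply: eq_bigr => k _; rewrite coef_fpsD coef_fpsN coef_fpsCM.
    rewrite sumrB -mulr_sumr; congr (_ - _).
    by rewrite big_ltn // big_nat big1 ?addr0 // => -[].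
  have cz := cvgB (cvgM (cvg_cst t) (@cvg_series_fexpc R z)) (cvg_cst (1 : C)).
  apply: cvg_trans (cz _ _ _ _); apply: near_eq_cvg.
  by exists 1%N => // -[|n] // _; rewrite dz.
Unshelve. all: by end_near. Qed.

Definition egf_bernoulli : fps R := Fps (fun k => bernoulli_number R k / k`!%:R).

Lemma egf_bernoulliP : fpsX = (fexp 1 - 1) * egf_bernoulli.
Proof.
pose g : fps R := Fps (fun k => (k.+1`!%:R)^-1).
have Xg : fpsX * g = fexp 1 - 1.
  apply/fpsP => -[|k]; rewrite coef_fpsD coef_fpsN coef_fps1.
    by rewrite coef0_fpsXM /= divr1 subrr.
  by rewrite coefS_fpsXM /= expr1n mul1r subr0.
rewrite -Xg -mulrA -[LHS]mulr1; congr (_ * _).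
symmetry; apply: (@egf_coef_inv R g 1).
- exact: cvg_half.
- by rewrite invr_eq0 pnatr_eq0.
- by move=> k; apply: norm_invfact_le1.
- near=> x; have x0 : x != 0 by near: x; exact: nbhs_dnbhs_neq.
  rewrite invf_div.
  have dx n : series (dilate x g) n = (series (fexp x) n.+1 - 1) / x.
    rewrite /series /= big_nat_recl //= divr1 addrAC subrr add0r mulr_suml.
    by apply: eq_bigr => k _; rewrite exprS; field; rewrite x0 pnatr_eq0 -lt0n fact_gt0.
  have cx : (fun n => (series (fexp x) n.+1 - 1) / x) @ \oo --> (expR x - 1) / x.
    apply: cvgM; last exact: cvg_cst.
    apply: cvgB; last exact: cvg_cst.
    by have := @cvg_series_fexp R x; rewrite -(cvg_shiftS (series (fexp x))).
  by apply: cvg_trans cx; apply: near_eq_cvg; near=> n.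
Unshelve. all: by end_near. Qed.

(** With u = e^{iz}, the partial fraction u / (u^2 - 1) = 1 / (u - 1) -
    1 / (u^2 - 1) reads z / sin z = 2 B(iz) - B(2iz), B being the generating
    series of the Bernoulli numbers. *)
Lemma fxcsc_bernoulli (B : fps C) :
  (fexp 1 - 1) * B = fpsX ->
  fxcsc 'i%C = fpsC 2 * dilate 'i%C B - dilate (2 * 'i%C) B.
Proof.
move=> BE; set i : C := 'i%C.
have i2 : i * i = -1 by rewrite -expr2 sqr_i.
have i0 : i != 0.
  by apply/eqP => i0; move/eqP: i2; rewrite i0 mul0r eq_sym oppr_eq0 oner_eq0.
have dX (a : C) : dilate a fpsX = fpsC a * fpsX.
  apply/fpsP => k; rewrite coef_fpsCM /=.
  by case: eqP => [->|_]; rewrite ?mulr0 ?expr1.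
have dB (a : C) : (fexp a - 1) * dilate a B = fpsC a * fpsX.
  have := congr1 (dilate a) BE.
  by rewrite rmorphM rmorphB rmorph1 /= dilate_fexp mulr1 dX.
symmetry; apply: (fxcsc_uniq i2); apply: fpsX_inj.
rewrite mulrA (fpsX_fsinc i2) mulr1 /fsin.
(* The partial fraction identity is cleared of denominators with E = e^{iz}
   and E' = e^{-iz}. *)
have E2 : fexp (2 * i) = fexp i * fexp i by rewrite -fexpD -mulr2n mulr_natl.
have EE := fexpNK i; have B1 := dB i; have := dB (2 * i); rewrite E2.
move: (dilate i B) (dilate (2 * i) B) B1 EE => B1 B2.
move: (fexp i) (fexp (- i)) => E E' e1 EE e2.
transitivity (fpsC (2 * i)^-1 * (E' * (E + 1) * fpsC 2 * ((E - 1) * B1)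
   - E' * ((E * E - 1) * B2) + (E * E' - 1) * (E * B2 - B1 * fpsC 2 * E))).
  by ring.
rewrite e1 e2 EE subrr mul0r addr0.
have -> : fpsC (2 * i) = fpsC 2 * fpsC i :> fps C by rewrite rmorphM.
transitivity (fpsC (2 * i)^-1 * fpsC 2 * fpsC i * (E * E') * fpsX).
  by ring.
rewrite EE mulr1 -!rmorphM -mulrA mulVf ?rmorph1 ?mul1r //.
by rewrite mulf_neq0 // pnatr_eq0.
Qed.

Lemma coef_fxcsc_double j : fxcsc 'i%C j.*2 = - (G R j)%:C :> C.
Proof.
pose B : fps C := Fps (fun k => (egf_bernoulli k)%:C).
have BE : (fexp 1 - 1) * B = fpsX.
  have := congr1 (fps_map (real_complex R)) egf_bernoulliP.
  rewrite fps_mapM => BE.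
  have -> : fpsX = fps_map (real_complex R) fpsX.
    by apply/fpsP => k /=; rewrite rmorph_nat.
  rewrite BE; congr (_ * _); apply/fpsP => k /=.
  rewrite rmorphB rmorphM fmorphV !rmorph_nat rmorphXn rmorph1.
  by congr (_ - _); case: k => [|k]; rewrite /= ?rmorph0 ?rmorph1.
rewrite (fxcsc_bernoulli BE) coef_fpsD coef_fpsN coef_fpsCM /=.
have -> : G R j = (-1) ^+ j * (2 ^+ (2 * j) - 2) *
    (bernoulli_number R (2 * j) / (2 * j)`!%:R).
  rewrite /G expfzDr ?pnatr_eq0 //.
  rewrite -[2 ^ (2 * j)%:Z]/(2 ^+ (2 * j)) -[2 ^ (-1)]/(2^-1 : R).
  by field; rewrite pnatr_eq0 -lt0n fact_gt0.
have i2j : 'i%C ^+ (2 * j) = (-1) ^+ j :> C by rewrite exprM sqr_i.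
rewrite -mul2n exprMn i2j.
move: (bernoulli_number R (2 * j) / _) => b.
rewrite rmorphM rmorphM rmorphB rmorphXn rmorphN1 rmorphXn !rmorph_nat /=.
by ring.
Qed.
End Coefficients.

(** * Roots of unity and coefficients of products *)

Lemma sum_prim_root (K : fieldType) (d : nat) (q : K) k : d.-primitive_root q ->
  \sum_(j < d) q ^+ (j * k) = if (d %| k)%N then d%:R else 0.
Proof.
move=> qd; case: ifPn => [/dvdnP[l ->]|dk].
  under eq_bigr do rewrite mulnA mulnC exprM (prim_expr_order qd) expr1n.
  by rewrite sumr_const card_ord.
have qk1 : q ^+ k - 1 != 0 by rewrite subr_eq0 -(prim_order_dvd qd).
under eq_bigr do rewrite mulnC exprM.
apply: (mulfI qk1); rewrite -subrX1 mulr0 -exprM mulnC exprM.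
by rewrite (prim_expr_order qd) expr1n subrr.
Qed.

(** For Z = e^{i pi / d} and W = e^{i w}, this is the partial fraction
    decomposition
      sum_j sin (m pi j / d) csc (pi j / d + w) = d sin ((d - m) w) / sin (d w)
    cleared of its denominators. With y = Z^{2j} W^2 one has y^d = W^{2d}, so
    each term times W^{2d} - 1 becomes the geometric sum (y^d - 1) / (y - 1);
    summing over j then keeps a single power of W, as Z^2 is a primitive d-th
    root of unity. *)
Lemma sum_kernel (S : comNzRingType) (Z Z' W W' : S) (g : nat -> S) (m d : nat) :
  (forall k, \sum_(j < d) Z ^+ (2 * (j * k)) = if (d %| k)%N then d%:R else 0) ->
  Z * Z' = 1 -> W * W' = 1 -> Z ^+ (2 * d) = 1 -> odd m -> (m < d)%N ->
  (forall j, (Z ^+ j * W - Z' ^+ j * W') * g j = 1) ->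
  (W ^+ (2 * d) - 1) * \sum_(j < d) (Z ^+ (m * j) - Z' ^+ (m * j)) * g j
  = d%:R * (W ^+ (2 * d - m) - W ^+ m).
Proof.
move=> orth ZZ' WW' Zd m_odd md gP.
pose a := m./2; have ma : m = (2 * a).+1.
  by rewrite -[LHS]odd_double_half m_odd add1n mul2n.
have ad : (a < d)%N by rewrite (leq_ltn_trans _ md) // ma; lia.
have ZZ'n n : Z ^+ n * Z' ^+ n = 1 by rewrite -exprMn ZZ' expr1n.
have gE j : (W ^+ (2 * d) - 1) * g j =
    \sum_(l < d) Z ^+ (j * (2 * l).+1) * W ^+ (2 * l).+1.
  pose y := Z ^+ (2 * j) * W ^+ 2.
  have yd : y ^+ d = W ^+ (2 * d).
    by rewrite exprMn -!exprM mulnAC exprM Zd expr1n mul1r.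
  have y1 : (y - 1) * g j = Z ^+ j * W.
    have -> : y - 1 = Z ^+ j * W * (Z ^+ j * W - Z' ^+ j * W').
      rewrite /y mulrBr [X in _ = _ - X]mulrACA ZZ'n WW' mulr1 mul2n -addnn exprD.
      by ring.
    by rewrite -mulrA gP mulr1.
  rewrite -yd subrX1 mulrAC y1 mulr_sumr; apply: eq_bigr => l _.
  rewrite /y exprMn -!exprM mulnS exprD exprS.
  rewrite (_ : j * (2 * l) = 2 * j * l)%N; last by lia.
  by ring.
rewrite mulr_sumr.
have -> : \sum_(j < d) (W ^+ (2 * d) - 1) * ((Z ^+ (m * j) - Z' ^+ (m * j)) * g j)
  = \sum_(l < d) W ^+ (2 * l).+1 *
      (\sum_(j < d) Z ^+ (2 * (j * (l + a).+1))
       - \sum_(j < d) Z ^+ (2 * (j * (l + (d - a))))).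
  under eq_bigr => j _ do rewrite mulrCA gE mulr_sumr.
  rewrite exchange_big; apply: eq_bigr => l _ /=.
  rewrite -sumrB mulr_sumr; apply: eq_bigr => j _.
  rewrite mulrA mulrC; congr (_ * _); rewrite mulrBl; congr (_ - _).
    by rewrite -exprD; congr (_ ^+ _); rewrite ma; lia.
  (* Negative powers of Z are traded for positive ones using Z^{2d} = 1. *)
  rewrite -[LHS]mulr1 -[1](expr1n _ j) -Zd -exprM -mulrA -exprD.
  have -> : (j * (2 * l).+1 + 2 * d * j = m * j + 2 * (j * (l + (d - a))))%N.
    rewrite ma; have := subnKC (ltnW ad); move: (d - a)%N => e.
    by move: (nat_of_ord j) (nat_of_ord l) => j' l' <-; nia.
  by rewrite exprD mulrA [Z' ^+ _ * _]mulrC ZZ'n mul1r.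
under eq_bigr do rewrite !orth mulrBr.
rewrite sumrB mulrBr; congr (_ - _).
  (* A multiple l + a + 1 of d lies between 1 and 2 d - 1, so it is d. *)
  have lt_l : (d - a.+1 < d)%N by lia.
  rewrite (bigD1 (Ordinal lt_l)) //= big1 => [|l ne].
    rewrite addr0 (_ : (d - a.+1 + a).+1 = d) ?dvdnn; last by lia.
    by rewrite mulrC (_ : (2 * (d - a.+1)).+1 = 2 * d - m)%N // ma; lia.
  case: ifP; rewrite ?mulr0 // => dv; case/negP: ne; apply/eqP/val_inj => /=.
  have := ltn_ord l; case/dvdnP: dv => -[|[|k]]; rewrite ?mulSn; nia.
(* A multiple l + d - a of d lies between 1 and 2 d - 1, so it is d. *)
rewrite (bigD1 (Ordinal ad)) //= big1 => [|l ne].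
  by rewrite addr0 subnKC ?dvdnn 1?ltnW // mulrC -ma.
case: ifP; rewrite ?mulr0 // => dv; case/negP: ne; apply/eqP/val_inj => /=.
have := ltn_ord l; case/dvdnP: dv => -[|[|k]]; rewrite ?mulSn; nia.
Qed.

Section Truncation.
Variable K : comNzRingType.
Implicit Types f g : fps K.

(** Congruence modulo z^n. *)
Definition eq_trunc n f g := forall k, (k < n)%N -> f k = g k.

Lemma eq_truncM n f f' g g' :
  eq_trunc n f f' -> eq_trunc n g g' -> eq_trunc n (f * g) (f' * g').
Proof.
move=> ff' gg' k kn; rewrite !coef_fpsM; apply: eq_bigr => i _.
rewrite ff' ?gg' //; first by rewrite (leq_ltn_trans _ kn) ?leq_subr.
by rewrite (leq_ltn_trans _ kn) ?leq_ord.
Qed.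

Lemma eq_truncX n f g m : eq_trunc n f g -> eq_trunc n (f ^+ m) (g ^+ m).
Proof.
by move=> fg; elim: m => [|m IH]; rewrite ?expr0 // !exprS; apply: eq_truncM.
Qed.

Lemma eq_trunc_sum n f : eq_trunc n f (\sum_(i < n) fpsC (f i) * fpsX ^+ i).
Proof.
move=> k kn; rewrite coef_fps_sum (bigD1 (Ordinal kn)) // big1 => [|i ne].
  by rewrite coef_fpsCM coef_fpsXn /= eqxx mulr1 addr0.
rewrite coef_fpsCM coef_fpsXn; case: eqP => [ki|_]; rewrite ?mulr0 //.
by case/eqP: ne; apply/val_inj.
Qed.

Lemma eq_trunc_sum_even n f : (forall k, odd k -> f k = 0) ->
  eq_trunc n f (\sum_(i < n) fpsC (f (2 * i)%N) * fpsX ^+ (2 * i)).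
Proof.
move=> f_even k kn; rewrite coef_fps_sum.
have [k_odd|k_even] := boolP (odd k).
  rewrite f_even // big1 // => i _; rewrite coef_fpsCM coef_fpsXn.
  by case: eqP k_odd => [->|]; rewrite ?mulr0 // mul2n odd_double.
have k2 : (k./2 < n)%N by lia.
rewrite (bigD1 (Ordinal k2)) // big1 => [|i ne].
  rewrite coef_fpsCM coef_fpsXn /= (_ : (2 * k./2)%N = k) ?eqxx ?mulr1 ?addr0 //.
  by lia.
rewrite coef_fpsCM coef_fpsXn; case: eqP => [ki|_]; rewrite ?mulr0 //.
by case/eqP: ne; apply/val_inj => /=; lia.
Qed.

(** In the coefficient of z^{N-1} all series may be truncated below z^N, which
    makes the index sets finite; the power is then expanded by
    distributivity. *)
Lemma coef_mul_even_expn N e a f : (0 < N)%N -> (forall k, odd k -> f k = 0) ->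
  (e * a * f ^+ N) N.-1 =
  \sum_(j : {ffun 'I_N -> 'I_N}) \sum_(mu < N)
    \sum_(nu < N | ((\sum_r 2 * j r) + mu + nu == N.-1)%N)
      e mu * a nu * \prod_r f (2 * j r)%N.
Proof.
move=> N0 f_even.
have Nlt : (N.-1 < N)%N by rewrite prednK.
rewrite (eq_truncM (eq_truncM (eq_trunc_sum e) (eq_trunc_sum a))
  (eq_truncX N (eq_trunc_sum_even f_even)) Nlt).
rewrite -[X in _ ^+ X]card_ord -prodr_const bigA_distr_bigA mulr_sumr coef_fps_sum.
apply: eq_bigr => j _.
rewrite !mulr_suml coef_fps_sum; apply: eq_bigr => mu _.
rewrite mulr_sumr mulr_suml coef_fps_sum [RHS]big_mkcond.
apply: eq_bigr => nu _.
have -> : fpsC (e mu) * fpsX ^+ mu * (fpsC (a nu) * fpsX ^+ nu) *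
    \prod_i (fpsC (f (2 * j i)%N) * fpsX ^+ (2 * j i)) =
    fpsC (e mu * a nu * \prod_r f (2 * j r)%N) *
    fpsX ^+ (\sum_r 2 * j r + mu + nu).
  rewrite big_split /= -rmorph_prod -expr_sum !rmorphM !exprD /=.
  by ring.
rewrite coef_fpsCM coef_fpsXn eq_sym.
by case: ifP; rewrite ?mulr1 ?mulr0.
Qed.

End Truncation.

(** * The unit circle *)

Section UnitCircle.
Variable R : realType.
Implicit Types x y : R.

Definition cis x : R[i] := cos x +i* sin x.

Lemma cisE x : cis x = (cos x)%:C + 'i%C * (sin x)%:C.
Proof. exact: complexE. Qed.

Lemma cis0 : cis 0 = 1. Proof. by rewrite /cis cos0 sin0. Qed.

Lemma cisD x y : cis (x + y) = cis x * cis y.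
Proof. by rewrite /cis cosD sinD; congr (_ +i* _); rewrite addrC [cos x * _]mulrC. Qed.

Lemma cisNK x : cis x * cis (- x) = 1.
Proof. by rewrite -cisD subrr cis0. Qed.

Lemma cisMn x n : cis (x * n%:R) = cis x ^+ n.
Proof.
elim: n => [|n IH]; first by rewrite mulr0 cis0.
by rewrite exprS -IH -cisD -natr1 mulrDr mulr1 addrC.
Qed.

Lemma cexp_imag x : cexp ('i%C * x%:C) = cis x.
Proof.
by rewrite /cexp /= !mul0r !mul1r subr0 expR0 add0r mul1r.
Qed.

Lemma cis_pi : cis pi = -1.
Proof. by rewrite /cis cospi sinpi; apply/eqP; rewrite eq_complex /= oppr0 !eqxx. Qed.

Lemma sin_cis x : (sin x)%:C = (2 * 'i%C)^-1 * (cis x - cis (- x)).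
Proof.
have i2 : ('i%C : R[i]) != 0 by rewrite eq_complex /= oner_eq0 andbF.
by rewrite !cisE cosN sinN rmorphN /=; field.
Qed.

Lemma cos_cis x : (cos x)%:C = 2^-1 * (cis x + cis (- x)).
Proof. by rewrite !cisE cosN sinN rmorphN /=; field. Qed.

Lemma cis2_eq1 x : cis x ^+ 2 = 1 -> sin x = 0.
Proof.
move=> x1; have : cis x = cis (- x).
  by rewrite -[LHS]mulr1 -(cisNK x) mulrA -expr2 x1 mul1r.
move=> [_]; rewrite sinN => /eqP.
by rewrite -addr_eq0 -mulr2n mulrn_eq0 => /eqP.
Qed.

Lemma sin_pi_int (k : int) : sin (pi * k%:~R) = 0 :> R.
Proof.
have sin_nat n : sin (pi * n%:R) = 0 :> R.
  elim: n => [|n IH]; first by rewrite mulr0 sin0.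
  by rewrite -natr1 mulrDr mulr1 sinD IH sinpi mul0r mulr0 addr0.
case: k => n; first exact: sin_nat.
by rewrite NegzE mulrNz mulrN sinN sin_nat oppr0.
Qed.

Lemma sin_pi_eq0 (x : R) : sin (pi * x) = 0 -> exists k : int, x = k%:~R.
Proof.
move=> sx; exists (Num.floor x); apply/eqP; rewrite -subr_eq0.
set f := x - _.
have f0 : 0 <= f by rewrite subr_ge0 Num.Theory.floor_le.
have f1 : f < 1 by rewrite ltrBlDl -(intrD _ _ 1) Num.Theory.floorD1_gt.
have : sin (pi * f) = 0.
  by rewrite mulrBr sinB sx sin_pi_int mul0r mulr0 subrr.
apply: contra_eqT => fn0; rewrite gt_eqF // sin_gt0_pi //.
have fpos : 0 < f by rewrite lt_neqAle eq_sym fn0.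
by rewrite mulr_gt0 ?pi_gt0 //= gtr_pMr ?pi_gt0.
Qed.

Lemma prim_root_cis d : (0 < d)%N -> d.-primitive_root (cis (pi / d%:R) ^+ 2).
Proof.
move=> d0; have dR : (d%:R : R) != 0 by rewrite pnatr_eq0 -lt0n.
rewrite /primitive_root_of_unity d0; apply/forallP => i.
rewrite unity_rootE -exprM mulnC exprM -cisMn.
have [->|ne] := eqVneq i.+1 d.
  by rewrite divfK // cis_pi sqrrN expr1n eqxx.
rewrite eqbF_neg; apply/eqP => /cis2_eq1/eqP; rewrite gt_eqF // sin_gt0_pi //.
have id : (i.+1 < d)%N by rewrite ltn_neqAle ne ltn_ord.
apply/andP; split; first by rewrite mulr_gt0 ?divr_gt0 ?pi_gt0 ?ltr0n.
rewrite -mulrA gtr_pMr ?pi_gt0 // mulrC ltr_pdivrMr ?ltr0n //.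
by rewrite mul1r ltr_nat.
Qed.

End UnitCircle.

(** * The sum of odd powers of cosecants as a coefficient *)

Section FormalKernel.
Variables (K : numFieldType) (i zeta zeta' e e' : K) (m d : nat).
Hypotheses (i2 : i * i = -1) (zetaK : zeta * zeta' = 1) (eK : e * e' = 1).
Hypothesis zeta_prim : d.-primitive_root (zeta ^+ 2).
Hypotheses (m_odd : odd m) (md : (m < d)%N).
Variables s c t : nat -> K.
Hypothesis sE : forall j, s j = (2 * i)^-1 * (zeta ^+ j * e - zeta' ^+ j * e').
Hypothesis cE : forall j, c j = 2^-1 * (zeta ^+ j * e + zeta' ^+ j * e').
Hypothesis tE :
  forall j, t j = (2 * i)^-1 * (zeta ^+ (m * j) - zeta' ^+ (m * j)).
Hypothesis s_neq0 : forall j, s j != 0.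
Variables a a' : fps K.
Hypothesis aE : (fpsC (e' ^+ (2 * d)) * fexp (2 * i * d%:R) - 1) * a = 1.
Hypothesis a'E : (fpsC (e ^+ (2 * d)) * fexp (- (2 * i * d%:R)) - 1) * a' = 1.

Let i_neq0 : 2 * i != 0.
Proof.
rewrite mulf_neq0 ?pnatr_eq0 //.
by apply/eqP => i0; move/eqP: i2; rewrite i0 mul0r eq_sym oppr_eq0 oner_eq0.
Qed.

(** With e = e^{iw} and s_j = sin x_j, c_j = cos x_j for x_j = pi j / d + w,
    this is the partial fraction decomposition at w - z, expanded in powers of
    z. The factors a and a' are the expansions of 1 / (t e^{z'} - 1) for
    t = e^{-2idw} at z' = 2idz, and for t = e^{2idw} at z' = - 2idz. *)
Lemma kernel_series :
  \sum_(j < d) fpsC (t j) * fcscB i (s j) (c j) =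
  fpsC d%:R * (fpsC (- e' ^+ m) * (fexp (i * m%:R) * a)
               + fpsC (- e ^+ m) * (fexp (- (i * m%:R)) * a')).
Proof.
pose W := fpsC e * fexp (- i); pose W' := fpsC e' * fexp i.
have WW' : W * W' = 1.
  transitivity (fpsC e * fpsC e' * (fexp i * fexp (- i))).
    by rewrite /W /W'; ring.
  by rewrite fexpNK -rmorphM eK rmorph1 mulr1.
have ZZ' : fpsC zeta * fpsC zeta' = 1 by rewrite -rmorphM zetaK rmorph1.
have orth k : \sum_(j < d) fpsC zeta ^+ (2 * (j * k)) =
    if (d %| k)%N then d%:R else 0.
  under eq_bigr do rewrite exprM -!rmorphXn /=.
  rewrite -rmorph_sum (sum_prim_root k zeta_prim).
  by case: ifP => _; rewrite ?rmorph0 // rmorph_nat.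
have Zd : fpsC zeta ^+ (2 * d) = 1.
  by rewrite -rmorphXn exprM (prim_expr_order zeta_prim) rmorph1.
have ii1 : fpsC (2 * i) * fpsC (2 * i)^-1 = 1.
  by rewrite -rmorphM mulfV // rmorph1.
have half1 : fpsC (2^-1 : K) * 2 = 1.
  by rewrite -(rmorph_nat (@fpsC K)) -rmorphM mulVf ?rmorph1 // pnatr_eq0.
pose g j := fcscB i (s j) (c j) * fpsC (2 * i)^-1.
have gP j : (fpsC zeta ^+ j * W - fpsC zeta' ^+ j * W') * g j = 1.
  have -> : fpsC zeta ^+ j * W - fpsC zeta' ^+ j * W' =
      fpsC (2 * i) * fsinB i (s j) (c j).
    rewrite /fsinB /fcos /fsin sE cE.
    move: (2 * i) ii1 => k ii1; move: (2^-1 : K) half1 => h half1.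
    rewrite !rmorphM rmorphB rmorphD !rmorphM !rmorphXn /= /W /W'.
    move: (fpsC zeta ^+ j) (fpsC zeta' ^+ j) => z z'.
    transitivity (fpsC k * fpsC k^-1 * (fpsC h * 2) *
      (z * (fpsC e * fexp (- i)) - z' * (fpsC e' * fexp i))); last by ring.
    by rewrite ii1 half1 !mul1r.
  transitivity (fpsC (2 * i) * fpsC (2 * i)^-1 *
      (fsinB i (s j) (c j) * fcscB i (s j) (c j))).
    by rewrite /g; ring.
  by rewrite fsinB_fcscB // ii1 mulr1.
have sumE := sum_kernel orth ZZ' WW' Zd m_odd md gP.
have W2d : W ^+ (2 * d) = fpsC (e ^+ (2 * d)) * fexp (- (2 * i * d%:R)).
  rewrite exprMn fexpX rmorphXn; congr (_ * fexp _).
  by rewrite -(mulr_natr (- i)) natrM; ring.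
have W'2d : W' ^+ (2 * d) = fpsC (e' ^+ (2 * d)) * fexp (2 * i * d%:R).
  rewrite exprMn fexpX rmorphXn; congr (_ * fexp _).
  by rewrite -(mulr_natr i) natrM; ring.
move: aE a'E; rewrite -W2d -W'2d => aW' a'W.
have Wm : fpsC (- e ^+ m) * fexp (- (i * m%:R)) = - W ^+ m.
  by rewrite exprMn fexpX -(mulr_natr (- i)) mulNr rmorphN rmorphXn mulNr.
have W'm : fpsC (- e' ^+ m) * fexp (i * m%:R) = - W' ^+ m.
  by rewrite exprMn fexpX -(mulr_natr i) rmorphN rmorphXn mulNr.
have WW'n n : W ^+ n * W' ^+ n = 1 by rewrite -exprMn WW' expr1n.
(* 1 / (W^{-2d} - 1) = - W^{2d} / (W^{2d} - 1). *)
have aa' : a = - (W ^+ (2 * d) * a').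
  transitivity ((W ^+ (2 * d) - 1) * a' * a); first by rewrite a'W mul1r.
  transitivity (- (W ^+ (2 * d) * ((W' ^+ (2 * d) - 1) * a)) * a'
    + (W ^+ (2 * d) * W' ^+ (2 * d) - 1) * (a * a')); first by ring.
  by rewrite aW' WW'n; ring.
have Wdm : W ^+ (2 * d - m) = W ^+ (2 * d) * W' ^+ m.
  have -> : W ^+ (2 * d) = W ^+ (2 * d - m) * W ^+ m.
    by rewrite -exprD; congr (_ ^+ _); lia.
  by rewrite -mulrA WW'n mulr1.
have -> : \sum_(j < d) fpsC (t j) * fcscB i (s j) (c j) =
    \sum_(j < d) (fpsC zeta ^+ (m * j) - fpsC zeta' ^+ (m * j)) * g j.
  apply: eq_bigr => j _; rewrite tE rmorphM rmorphB !rmorphXn /= /g.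
  by ring.
rewrite (mulrA (fpsC (- e' ^+ m))) (mulrA (fpsC (- e ^+ m))) W'm Wm.
move: (\sum_(j < d) _) sumE => S sumE.
transitivity (a' * ((W ^+ (2 * d) - 1) * S)).
  by rewrite mulrA [a' * _]mulrC a'W mul1r.
by rewrite sumE Wdm aa' rmorph_nat; ring.
Qed.

Hypothesis s2Dc2 : forall j, s j ^+ 2 + c j ^+ 2 = 1.

(** The coefficient of z^{N-1} in sum_j t_j csc (x_j - z) (z / sin z)^N,
    computed term by term with the residue formula on the left, and from the
    closed form of the sum on the right. *)
Lemma sum_csc_power N : odd N ->
  \sum_(j < d) t j * (s j)^-1 ^+ N =
  \sum_(j : {ffun 'I_N -> 'I_N}) \sum_(mu < N)
    \sum_(nu < N | ((\sum_r 2 * j r) + mu + nu == N.-1)%N)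
      d%:R * (- e' ^+ m * ((i * m%:R) ^+ mu / mu`!%:R * a nu)
              + - e ^+ m * ((- (i * m%:R)) ^+ mu / mu`!%:R * a' nu))
      * \prod_r fxcsc i (2 * j r)%N.
Proof.
move=> N_odd; have NE : N = N./2.*2.+1.
  by rewrite -[LHS]odd_double_half N_odd.
have N_gt0 : (0 < N)%N by rewrite NE.
have phi_even k : odd k -> fxcsc i k = 0.
  by move=> k_odd; rewrite -[fxcsc i]expr1; exact: coef_odd_fxcscX.
transitivity (((\sum_(j < d) fpsC (t j) * fcscB i (s j) (c j)) * fxcsc i ^+ N) N.-1).
  rewrite mulr_suml coef_fps_sum; apply: eq_bigr => j _.
  rewrite -mulrA coef_fpsCM; congr (_ * _).
  by rewrite NE coef_fcscB_fxcscX.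
have coefE (x y z : K) (f g h f' g' : fps K) k :
    (fpsC x * (fpsC y * (f * g) + fpsC z * (f' * g')) * h) k =
    x * (y * (f * g * h) k + z * (f' * g' * h) k).
  by rewrite -mulrA coef_fpsCM mulrDl coef_fpsD -!(mulrA (fpsC _)) !coef_fpsCM.
rewrite kernel_series coefE !(coef_mul_even_expn _ _ N_gt0 phi_even).
rewrite 2!mulr_sumr -big_split mulr_sumr; apply: eq_bigr => j _.
rewrite 2!mulr_sumr -big_split mulr_sumr; apply: eq_bigr => mu _.
rewrite 2!mulr_sumr -big_split mulr_sumr; apply: eq_bigr => nu _ /=.
by ring.
Qed.

End FormalKernel.

(** * The trigonometric sum *)

Lemma prod_fxcsc (R : realType) N (j : 'I_N -> nat) : odd N ->
  \prod_r (fxcsc 'i%C (2 * j r)%N : R[i]) = - (F R j)%:C.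
Proof.
move=> N_odd; rewrite /F rmorph_prod.
transitivity (\prod_r - (G R (j r))%:C).
  by apply: eq_bigr => r _; rewrite mul2n coef_fxcsc_double.
by rewrite prodrN card_ord -signr_odd N_odd mulN1r.
Qed.

Lemma sin_shift_neq0 (R : realType) (d : nat) (b : R) j : (0 < d)%N ->
  (forall k : int, b <> k%:~R / d%:R) ->
  sin (pi * j%:R / d%:R + pi * b) != 0.
Proof.
move=> d0 b_nint; have dR : (d%:R : R) != 0 by rewrite pnatr_eq0 -lt0n.
apply/eqP; rewrite -mulrA -mulrDr => /sin_pi_eq0[k jb].
apply: (b_nint (k * d%:Z - j%:Z)).
have -> : b = k%:~R - j%:R / d%:R by rewrite -jb addrC addKr.
by rewrite intrD intrM intrN -!pmulrn; field.
Qed.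

(** The point e^{2 pi i d b} differs from 1 exactly because d b is not an
    integer. *)
Lemma cis_period_neq1 (R : realType) (d : nat) (b : R) : (0 < d)%N ->
  (forall k : int, b <> k%:~R / d%:R) -> cis (pi * b) ^+ (2 * d) != 1.
Proof.
move=> d0 b_nint; have dR : (d%:R : R) != 0 by rewrite pnatr_eq0 -lt0n.
rewrite mulnC exprM -cisMn; apply/eqP => /cis2_eq1.
rewrite -mulrA => /sin_pi_eq0[k bd]; apply: (b_nint k).
by rewrite -bd mulfK.
Qed.

Lemma dilate_egf_AP (R : realType) (t x : R[i]) : t != 1 ->
  (fpsC t * fexp x - 1) * dilate x (egf_A t) = 1.
Proof.
move=> t1; have := congr1 (dilate x) (egf_AP t1).
by rewrite rmorphM rmorphB rmorphM !rmorph1 /= dilateC dilate_fexp mulr1.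
Qed.

Lemma summandE (K : fieldType) (i x d p p' u v a a' f : K) mu nu :
  d * (p * ((i * x) ^+ mu / u * ((2 * i * d) ^+ nu * (a / v)))
    + p' * ((- (i * x)) ^+ mu / u * ((- (2 * i * d)) ^+ nu * (a' / v)))) * - f =
  - (i ^+ (mu + nu) * 2 ^+ nu * (x ^+ mu / u) * (d ^+ nu.+1 / v) *
     (p * a + (-1) ^+ (mu + nu) * p' * a') * f).
Proof.
rewrite (exprNn (i * x)) (exprNn (2 * i * d)) !exprMn !exprD exprS.
by move: (u^-1) (v^-1) => u' v'; ring.
Qed.

Unset Implicit Arguments.

(* The indices j_r, mu, nu range over all nonnegative integers subject to
   2 j_1 + ... + 2 j_(2n-1) + mu + nu = 2n - 2; this equation already makes
   each of them smaller than 2n - 1. *)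
Theorem theorem1p9 (R : realType) (m n d : nat) (b : R) :
  odd m -> (0 < n)%N -> (0 < d)%N -> (m < d)%N ->
  (forall k : int, b <> k%:~R / d%:R) ->
  let p1 : R[i] := cexp (- (pi%:C * 'i%C * m%:R * (b%:C - 1))) in
  let p2 : R[i] := cexp (- (2 * pi%:C * 'i%C * d%:R * b%:C)) in
  let p1' : R[i] := cexp (pi%:C * 'i%C * m%:R * (b%:C - 1)) in
  let p2' : R[i] := cexp (2 * pi%:C * 'i%C * d%:R * b%:C) in
  (\sum_(1 <= j < d)
     sin (pi * m%:R * j%:R / d%:R) *
     csc (pi * j%:R / d%:R + pi * b) ^+ (2 * n - 1))%:C =
  - \sum_(j : {ffun 'I_(2 * n - 1) -> 'I_(2 * n - 1)})
      \sum_(mu < 2 * n - 1)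
        \sum_(nu < 2 * n - 1 |
              ((\sum_r 2 * j r) + mu + nu == 2 * n - 2)%N)
          'i%C ^+ (mu + nu) * 2 ^+ nu *
          (m%:R ^+ mu / (mu`!)%:R) * (d%:R ^+ nu.+1 / (nu`!)%:R) *
          (p1 * A nu p2 + (-1) ^+ (mu + nu) * p1' * A nu p2') *
          (F R (fun r => j r))%:C.
Proof.
move=> m_odd n0 d0 md b_nint p1 p2 p1' p2'.
have p1E : p1 = - cis (- (pi * b)) ^+ m.
  have -> : p1 = cis (- (pi * b) * m%:R + pi * m%:R).
    rewrite -cexp_imag; congr cexp.
    by rewrite !(rmorphD, rmorphM, rmorphN, rmorph_nat) /=; ring.
  by rewrite cisD !cisMn cis_pi -signr_odd m_odd expr1 mulrN1.
have p1'E : p1' = - cis (pi * b) ^+ m.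
  have -> : p1' = cis (pi * b * m%:R + - pi * m%:R).
    rewrite -cexp_imag; congr cexp.
    by rewrite !(rmorphD, rmorphM, rmorphN, rmorph_nat) /=; ring.
  have cisNpi : cis (- pi) = -1 :> R[i].
    have := cisNK (pi : R); rewrite cis_pi mulN1r => /eqP.
    by rewrite eqr_oppLR => /eqP.
  by rewrite cisD !cisMn cisNpi -signr_odd m_odd expr1 mulrN1.
have p2E : p2 = cis (- (pi * b)) ^+ (2 * d).
  rewrite -cisMn -cexp_imag; congr cexp.
  by rewrite !(rmorphD, rmorphM, rmorphN, rmorph_nat, natrM) /=; ring.
have p2'E : p2' = cis (pi * b) ^+ (2 * d).
  rewrite -cisMn -cexp_imag; congr cexp.
  by rewrite !(rmorphD, rmorphM, rmorphN, rmorph_nat, natrM) /=; ring.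
have p2'1 : p2' != 1 by rewrite p2'E; exact: cis_period_neq1.
have p2p2' : p2 * p2' = 1.
  by rewrite p2E p2'E -exprMn mulrC cisNK expr1n.
have p21 : p2 != 1.
  by apply: contraNneq p2'1 => p21; rewrite -p2p2' p21 mul1r.
have -> : (2 * n - 2 = (2 * n - 1).-1)%N by lia.
have N_odd : odd (2 * n - 1) by lia.
move: (2 * n - 1)%N N_odd => N N_odd.
have i2 : 'i%C * 'i%C = -1 :> R[i] by rewrite -expr2 sqr_i.
pose x j : R := pi * j%:R / d%:R + pi * b.
have xE j : cis (x j) = cis (pi / d%:R) ^+ j * cis (pi * b).
  by rewrite -cisMn -cisD /x mulrAC.
have xNE j : cis (- x j) = cis (- (pi / d%:R)) ^+ j * cis (- (pi * b)).
  by rewrite -cisMn -cisD /x opprD mulNr mulrAC.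
have tE j : (sin (pi * m%:R * j%:R / d%:R))%:C = (2 * 'i%C)^-1 *
    (cis (pi / d%:R) ^+ (m * j) - cis (- (pi / d%:R)) ^+ (m * j)) :> R[i].
  rewrite -!cisMn mulNr sin_cis.
  have -> : pi * m%:R * j%:R / d%:R = pi / d%:R * (m * j)%N%:R :> R.
    by rewrite natrM; ring.
  by [].
have sE j : (sin (x j))%:C = (2 * 'i%C)^-1 * (cis (pi / d%:R) ^+ j * cis (pi * b)
    - cis (- (pi / d%:R)) ^+ j * cis (- (pi * b))) :> R[i].
  by rewrite sin_cis xE xNE.
have cE j : (cos (x j))%:C = 2^-1 * (cis (pi / d%:R) ^+ j * cis (pi * b)
    + cis (- (pi / d%:R)) ^+ j * cis (- (pi * b))) :> R[i].
  by rewrite cos_cis xE xNE.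
have s0 j : (sin (x j))%:C != 0 :> R[i].
  by rewrite -(rmorph0 (real_complex R)) (inj_eq (@complexI R)) sin_shift_neq0.
have s2Dc2 j : (sin (x j))%:C ^+ 2 + (cos (x j))%:C ^+ 2 = 1 :> R[i].
  by rewrite -!rmorphXn -rmorphD addrC cos2Dsin2 rmorph1.
have aE := dilate_egf_AP (2 * 'i%C * d%:R) p21.
have a'E := dilate_egf_AP (- (2 * 'i%C * d%:R)) p2'1.
rewrite {1}p2E in aE; rewrite {1}p2'E in a'E.
have sumE := sum_csc_power i2 (cisNK _) (cisNK _) (prim_root_cis R d0) m_odd md
  sE cE tE s0 aE a'E s2Dc2 N_odd.
transitivity (\sum_(j < d) (sin (pi * m%:R * j%:R / d%:R))%:C
    * (sin (x j))%:C^-1 ^+ N : R[i]).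
  (* The term of index 0 vanishes because sin 0 = 0. *)
  rewrite -(big_mkord xpredT (fun j => (sin (pi * m%:R * j%:R / d%:R))%:C
    * (sin (x j))%:C^-1 ^+ N : R[i])).
  rewrite [RHS]big_ltn // mulr0 mul0r sin0 rmorph0 mul0r add0r rmorph_sum.
  by apply: eq_bigr => j _; rewrite rmorphM rmorphXn fmorphV.
rewrite {}sumE -sumrN; apply: eq_bigr => j _.
rewrite -sumrN; apply: eq_bigr => mu _.
rewrite -sumrN; apply: eq_bigr => nu _.
rewrite (prod_fxcsc R (fun r => j r) N_odd) -p1E -p1'E.
exact: summandE.
Qed.
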